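(* Let $k$ be a field with algebraic closure $\bar k$, $G$ a group, $\gamma\in G$, $\chi\colon G\to k^\times$ a group homomorphism, and $c\in Z^1(G,k_\chi)$. Let $\sigma$ be the $k$-algebra automorphism of $kG$ with $\sigma(\tau)=\chi(\tau)\gamma\tau\gamma^{-1}$, and let $\delta_c$ be the $k$-linear $\sigma$-derivation with $\delta_c(\tau)=c(\tau)\gamma\tau$ ($\tau\in G$). Let $A=kG[t;\sigma,\delta_c]$ be $G$-graded with $\deg t=\gamma$. Let $\Phi\colon G\to\mathrm{Aff}(1,k)$, $\tau\mapsto\varphi_\tau$, be the group homomorphism with $\varphi_\tau(X)=\chi(\tau)X+c(\tau)$. \begin{enumerate} \item[(1)] $\delta_c$ is inner if and only if $c\in B^1(G,k_\chi)$. \item[(2)] Put $s=\gamma^{-1}t$. Then $A$ is isomorphic, as a $G$-graded ring, to the skew group ring $k[X]\rtimes_\theta G$, where $G$ acts on $k[X]$ by the affine substitutions $\theta_\tau(f)=f\circ\varphi_\tau^{-1}$. \item[(3)] $A$ is gr-simple if and only if $\Phi(G)$ has no finite orbit in $\bar k$, if and only if the restriction of $[c]$ to $H^1(H,k_\chi)$ is nonzero for every subgroup $H$ of finite index in $G$. If $\operatorname{char}k=0$, this holds if and only if $[c]\neq0$ in $H^1(G,k_\chi)$. \item[(4)] $A$ is simple if and only if it is gr-simple and $\Phi$ is injective. In particular, if $A$ is simple, then $G$ is metabelian. \end{enumerate}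
   Context: Crossed homomorphisms: $Z^1(G,k_\chi)$ is the $k$-space of maps $c\colon G\to k$ with $c(\tau\rho)=c(\tau)+\chi(\tau)c(\rho)$ for $\tau,\rho\in G$; $B^1(G,k_\chi)$ is the subspace of maps $x(\chi-1)$, i.e. $\tau\mapsto x(\chi(\tau)-1)$, with $x\in k$; $H^1(G,k_\chi)=Z^1/B^1$ and $[c]$ is the class of $c$. For a subgroup $H$, $H^1(H,k_\chi)$ is formed with $\chi|_H$. The group algebra $kG$ is $G$-graded by $(kG)_\tau=k\tau$. For a ring endomorphism $\sigma$ of a ring $R$, a $\sigma$-derivation is an additive map $\delta$ with $\delta(rs)=\delta(r)s+\sigma(r)\delta(s)$; the Ore extension $R[t;\sigma,\delta]$ is the free left $R$-module with basis $1,t,t^2,\dots$ with multiplication determined by $tr=\sigma(r)t+\delta(r)$. A $\sigma$-derivation $\delta$ is inner if there is $u\in R$ with $\delta(r)=ur-\sigma(r)u$ for all $r\in R$. Here $\sigma$ and $\delta_c$ are extended $k$-linearly from $G$ to $kG$, and the $G$-grading on $A$ is $A_\alpha=\bigoplus_{n\ge0}(kG)_{\alpha\gamma^{-n}}t^n$ ($\alpha\in G$). An ideal (two-sided) is graded if generated by homogeneous elements; a graded ring is gr-simple if $0$ and the ring itself are its only graded ideals. $\mathrm{Aff}(1,k)$ is the group of maps $X\mapsto aX+b$ with $a\in k^\times$, $b\in k$, under composition; it acts on $\bar k$ by $x\mapsto ax+b$. If $G$ acts on a ring $S$ by automorphisms $\theta_\tau$, the skew group ring $S\rtimes_\theta G=\bigoplus_{\tau\in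 G}Su_\tau$ has multiplication $(fu_\tau)(gu_\rho)=f\theta_\tau(g)u_{\tau\rho}$ and is $G$-graded by $\deg u_\tau=\tau$. A group is metabelian if it has an abelian normal subgroup with abelian quotient. *)

(* Defs.v *)
From HB Require Import structures.
From mathcomp Require Import all_boot all_algebra finmap.
From mathcomp.multinomials Require Import monalg.
From mathcomp Require Import boolp classical_sets functions cardinality.

Set Implicit Arguments.
Unset Strict Implicit.
Unset Printing Implicit Defensive.

Import GRing.Theory.
Local Open Scope classical_set_scope.
Local Open Scope ring_scope.

Record unit_group (k : fieldType) := UnitGroup {
  ugval :> k;
  ugvalP : ugval != 0
}.

HB.instance Definition _ (k : fieldType) := [isSub for @ugval k].
HB.instance Definition _ (k : fieldType) := [Choice of unit_group k by <:].

Section UnitGroup.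
Variable k : fieldType.
Implicit Types a b c : unit_group k.

Definition ug_one : unit_group k := UnitGroup (oner_neq0 k).

Lemma ug_mul_subproof a b : ugval a * ugval b != 0.
Proof. by rewrite mulf_neq0 ?ugvalP. Qed.
Definition ug_mul a b := UnitGroup (ug_mul_subproof a b).

Lemma ug_inv_subproof a : (ugval a)^-1 != 0.
Proof. by rewrite invr_eq0 ugvalP. Qed.
Definition ug_inv a := UnitGroup (ug_inv_subproof a).

Lemma ug_mulA : associative ug_mul.
Proof. by move=> a b c; apply/val_inj; rewrite /= mulrA. Qed.
Lemma ug_mul1 : left_id ug_one ug_mul.
Proof. by move=> a; apply/val_inj; rewrite /= mul1r. Qed.
Lemma ug_mulr1 : right_id ug_one ug_mul.
Proof. by move=> a; apply/val_inj; rewrite /= mulr1. Qed.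
Lemma ug_mulV : left_inverse ug_one ug_inv ug_mul.
Proof. by move=> a; apply/val_inj; rewrite /= mulVf ?ugvalP. Qed.
Lemma ug_mulrV : right_inverse ug_one ug_inv ug_mul.
Proof. by move=> a; apply/val_inj; rewrite /= mulfV ?ugvalP. Qed.

HB.instance Definition _ := isGroup.Build (unit_group k)
  ug_mulA ug_mul1 ug_mulr1 ug_mulV ug_mulrV.

End UnitGroup.

(* Aff a b is the map X |-> a X + b; aff_funM shows that the group law is
   composition. *)
Record aff (k : fieldType) := Aff {
  aff_lin : unit_group k;
  aff_tr : k
}.

Definition aff_pair (k : fieldType) (p : aff k) := (aff_lin p, aff_tr p).
Definition pair_aff (k : fieldType) (x : unit_group k * k) := Aff x.1 x.2.
Lemma aff_pairK (k : fieldType) : cancel (@aff_pair k) (@pair_aff k).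
Proof. by case. Qed.

HB.instance Definition _ (k : fieldType) :=
  Choice.copy (aff k) (can_type (@aff_pairK k)).

Section Aff.
Variable k : fieldType.
Implicit Types p q r : aff k.

Definition aff_one : aff k := Aff 1%g 0.
Definition aff_mul p q : aff k :=
  Aff (aff_lin p * aff_lin q)%g (ugval (aff_lin p) * aff_tr q + aff_tr p).
Definition aff_inv p : aff k :=
  Aff (aff_lin p)^-1%g (- ((ugval (aff_lin p))^-1 * aff_tr p)).

Lemma aff_mulA : associative aff_mul.
Proof.
move=> p q r; rewrite /aff_mul /=; congr Aff; first exact: mulgA.
by rewrite mulrDr mulrA addrA.
Qed.
Lemma aff_mul1 : left_id aff_one aff_mul.
Proof. by case=> a b; rewrite /aff_mul /= mul1g mul1r addr0. Qed.
Lemma aff_mulr1 : right_id aff_one aff_mul.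
Proof. by case=> a b; rewrite /aff_mul /= mulg1 mulr0 add0r. Qed.
Lemma aff_mulV : left_inverse aff_one aff_inv aff_mul.
Proof. by case=> a b; rewrite /aff_mul /= mulVg subrr. Qed.
Lemma aff_mulrV : right_inverse aff_one aff_inv aff_mul.
Proof.
by case=> a b; rewrite /aff_mul /= mulgV mulrN mulVKf ?ugvalP ?addNr.
Qed.

HB.instance Definition _ := isGroup.Build (aff k)
  aff_mulA aff_mul1 aff_mulr1 aff_mulV aff_mulrV.

Definition aff_fun p (x : k) : k := ugval (aff_lin p) * x + aff_tr p.

Lemma aff_funM p q : aff_fun (p * q)%g = aff_fun p \o aff_fun q.
Proof. by apply/funext=> x; rewrite /aff_fun /= mulrDr mulrA addrA. Qed.

Definition aff_poly p : {poly k} := ugval (aff_lin p) *: 'X + (aff_tr p)%:P.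

Lemma aff_poly1 : aff_poly 1%g = 'X.
Proof. by rewrite /aff_poly /= scale1r addr0. Qed.

Lemma aff_polyM p q : aff_poly (p * q)%g = aff_poly p \Po aff_poly q.
Proof.
rewrite /aff_poly comp_polyD comp_polyZ comp_polyX comp_polyC /=.
by rewrite scalerDr scalerA polyCD polyCM mul_polyC addrA.
Qed.

Definition aff_act (K : fieldType) (iota : {rmorphism k -> K}) p (x : K) : K :=
  iota (ugval (aff_lin p)) * x + iota (aff_tr p).

End Aff.

Section Cohomology.
Variables (k : fieldType) (G : groupType).
Variable chi : UMagmaMorphism.type G (unit_group k).

Definition crossed_hom : {pred G -> k} := fun c =>
  `[< forall t r : G, c (t * r)%g = c t + ugval (chi t) * c r >].

Lemma crossed_hom_zmod : zmod_closed crossed_hom.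
Proof.
split=> [|c d /asboolP hc /asboolP hd]; apply/asboolP=> t r.
  by rewrite mulr0 addr0.
have E x : (c - d) x = c x - d x by [].
by rewrite !E hc hd mulrBr opprD addrACA.
Qed.
HB.instance Definition _ :=
  GRing.isZmodClosed.Build (G -> k) crossed_hom crossed_hom_zmod.

Record Z1 := CrossedHom { Z1val :> G -> k; Z1valP : Z1val \in crossed_hom }.

HB.instance Definition _ := [isSub for Z1val].
HB.instance Definition _ := [Choice of Z1 by <:].
HB.instance Definition _ := [SubChoice_isSubZmodule of Z1 by <:].

Lemma Z1E (c : Z1) (t r : G) : c (t * r)%g = c t + ugval (chi t) * c r.
Proof. by have /asboolP := Z1valP c. Qed.

Definition B1 : {pred Z1} := fun c =>
  `[< exists x : k, forall t : G, c t = x * (ugval (chi t) - 1) >].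

Lemma B1_zmod : zmod_closed B1.
Proof.
split=> [|c d /asboolP[x hx] /asboolP[y hy]]; apply/asboolP.
  by exists 0 => t; rewrite mul0r.
exists (x - y) => t; have -> : (c - d) t = c t - d t by [].
by rewrite hx hy mulrBl.
Qed.
HB.instance Definition _ := GRing.isZmodClosed.Build Z1 B1 B1_zmod.

Definition H1 := Quotient.quot B1.
HB.instance Definition _ := GRing.Zmodule.on H1.

Definition H1_class (c : Z1) : H1 := (\pi_(Quotient.quot B1) c)%qT.

End Cohomology.

Arguments B1 {k G} chi _.

Section Restriction.
Variables (G : groupType) (H : groupClosed G).

Record subgroup := Subgroup { sgval :> G; sgvalP : sgval \in H }.

HB.instance Definition _ := [isSub for sgval].
HB.instance Definition _ := [Choice of subgroup by <:].

Lemma subgroup_closed : group_closed H.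
Proof. by split; [exact: gpred1 | move=> x y; exact: gpredF]. Qed.
HB.instance Definition _ :=
  SubChoice_isSubGroup.Build G (mem H) subgroup subgroup_closed.

End Restriction.

Section RestrictCocycle.
Variables (k : fieldType) (G : groupType).
Variables (chi : UMagmaMorphism.type G (unit_group k)) (H : groupClosed G).

Definition res_char : UMagmaMorphism.type (subgroup H) (unit_group k) :=
  chi \o (val : subgroup H -> G).

Lemma res_cocycle_subproof (c : Z1 chi) :
  (c \o (val : subgroup H -> G)) \in crossed_hom res_char.
Proof. by apply/asboolP=> t r /=; rewrite Z1E. Qed.
Definition res_cocycle (c : Z1 chi) : Z1 res_char :=
  CrossedHom (res_cocycle_subproof c).

End RestrictCocycle.

Definition lcoset_of (G : groupType) (N : groupClosed G) (g : G) : set G :=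
  [set (g * n)%g | n in [set` N]].

Definition finite_index (G : groupType) (H : groupClosed G) : Prop :=
  finite_set [set lcoset_of H g | g in [set: G]].

Definition metabelian (G : groupType) : Prop :=
  exists N : groupClosed G,
    [/\ (forall g n : G, n \in N -> (n ^ g)%g \in N),
        (forall m n : G, m \in N -> n \in N -> (m * n = n * m)%g)
      & (* (xN)(yN) = (yN)(xN) in G / N *)
        forall x y : G, lcoset_of N (x * y)%g = lcoset_of N (y * x)%g].

Section Phi.
Variables (k : fieldType) (G : groupType).
Variables (chi : UMagmaMorphism.type G (unit_group k)) (c : Z1 chi).

Definition Phi (t : G) : aff k := Aff (chi t) (c t).

Lemma Phi_morph : monoid.monoid_morphism Phi.
Proof.
split; last first.
  by move=> t r; rewrite /Phi gmulfM Z1E addrC.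
have h : c 1%g = 0.
  have := Z1E c 1%g 1%g; rewrite mulg1 gmulf1 /= mul1r.
  by move/esym/eqP; rewrite -[X in _ == X]addr0 => /eqP/addrI.
by rewrite /Phi gmulf1 h.
Qed.
HB.instance Definition _ := isUMagmaMorphism.Build G (aff k) Phi Phi_morph.

End Phi.

(* An element of skew_ring th is a finitely supported function G -> S, and
   << f *g t >> stands for f u_t. *)

Record ring_action (G : groupType) (S : nzRingType) := RingAction {
  ract :> G -> {rmorphism S -> S};
  ract1 : forall s, ract 1%g s = s;
  ractM : forall t r s, ract (t * r)%g s = ract t (ract r s)
}.

Definition skew_ring (G : groupType) (S : nzRingType) (th : ring_action G S)
  : Type := {malg S[G]}.

HB.lock Definition skew_mul (G : groupType) (S : nzRingType)
    (th : ring_action G S) (x y : {malg S[G]}) : {malg S[G]} :=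
  \sum_(t <- msupp x) \sum_(r <- msupp y)
     << x@_t * th t (y@_r) *g (t * r)%g >>.

Section SkewRing.
Variables (G : groupType) (S : nzRingType) (th : ring_action G S).
Local Notation T := (skew_ring th).
Implicit Types x y z : {malg S[G]}.

HB.instance Definition _ := GRing.Lmodule.on T.

Definition skew_one : {malg S[G]} := << 1 *g 1%g >>.
Local Notation skew_mul := (@skew_mul G S th).

Lemma skew_mulw (d e : {fset G}) x y :
  (msupp x `<=` d)%fset -> (msupp y `<=` e)%fset ->
  skew_mul x y =
  \sum_(t <- d) \sum_(r <- e) << x@_t * th t (y@_r) *g (t * r)%g >>.
Proof.
move=> led lee; rewrite skew_mul.unlock (big_fset_incl _ led) /=.
  apply/eq_bigr=> t _; apply/big_fset_incl => // r _ /mcoeff_outdom ->.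
  by rewrite rmorph0 mulr0 monalgU0.
move=> t _ /mcoeff_outdom xt.
by rewrite big1 // => r _; rewrite xt mul0r monalgU0.
Qed.

Lemma skew_mulDl : left_distributive skew_mul +%R.
Proof.
move=> x y z.
rewrite (skew_mulw (msuppD_le x y) (fsubset_refl _)).
rewrite (skew_mulw (fsubsetUl _ (msupp y)) (fsubset_refl (msupp z))).
rewrite (skew_mulw (fsubsetUr (msupp x) _) (fsubset_refl (msupp z))).
rewrite -big_split /=; apply/eq_bigr=> t _.
rewrite -big_split /=; apply/eq_bigr=> r _.
by rewrite mcoeffD mulrDl monalgUD.
Qed.

Lemma skew_mulDr : right_distributive skew_mul +%R.
Proof.
move=> x y z.
rewrite (skew_mulw (fsubset_refl _) (msuppD_le y z)).
rewrite (skew_mulw (fsubset_refl (msupp x)) (fsubsetUl _ (msupp z))).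
rewrite (skew_mulw (fsubset_refl (msupp x)) (fsubsetUr (msupp y) _)).
rewrite -big_split /=; apply/eq_bigr=> t _.
rewrite -big_split /=; apply/eq_bigr=> r _.
by rewrite mcoeffD rmorphD mulrDr monalgUD.
Qed.

Lemma skew_mul0l : left_zero 0 skew_mul.
Proof. by move=> x; rewrite skew_mul.unlock msupp0 big_seq_fset0. Qed.
Lemma skew_mul0r : right_zero 0 skew_mul.
Proof.
by move=> x; rewrite skew_mul.unlock msupp0 big1 // => t _; rewrite big_seq_fset0.
Qed.

Lemma skew_mulUU f g (t r : G) :
  skew_mul << f *g t >> << g *g r >> = << f * th t g *g (t * r)%g >>.
Proof. by rewrite (skew_mulw msuppU_le msuppU_le) !big_seq_fset1 !mcoeffUU. Qed.

Lemma skew_mul_suml I (s : seq I) F y :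
  skew_mul (\sum_(i <- s) F i) y = \sum_(i <- s) skew_mul (F i) y.
Proof.
exact: (big_morph (skew_mul^~ y) (fun a b => skew_mulDl a b y) (skew_mul0l y)).
Qed.
Lemma skew_mul_sumr I (s : seq I) F x :
  skew_mul x (\sum_(i <- s) F i) = \sum_(i <- s) skew_mul x (F i).
Proof.
exact: (big_morph (skew_mul x) (fun a b => skew_mulDr x a b) (skew_mul0r x)).
Qed.

Lemma skew_mulEl x y :
  skew_mul x y = \sum_(t <- msupp x) skew_mul << x@_t *g t >> y.
Proof. by rewrite [in LHS](monalgE x) skew_mul_suml. Qed.
Lemma skew_mulEr x y :
  skew_mul x y = \sum_(t <- msupp y) skew_mul x << y@_t *g t >>.
Proof. by rewrite [in LHS](monalgE y) skew_mul_sumr. Qed.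

Lemma skew_mul1l : left_id skew_one skew_mul.
Proof.
move=> x; rewrite skew_mulEr [RHS]monalgE.
by apply/eq_bigr=> t _; rewrite skew_mulUU ract1 mul1r mul1g.
Qed.

Lemma skew_mul1r : right_id skew_one skew_mul.
Proof.
move=> x; rewrite skew_mulEl [RHS]monalgE.
by apply/eq_bigr=> t _; rewrite skew_mulUU rmorph1 mulr1 mulg1.
Qed.

Lemma skew_mulA : associative skew_mul.
Proof.
move=> x y z; rewrite [LHS]skew_mulEl (skew_mulEl x y) [RHS]skew_mul_suml.
apply/eq_bigr=> t _.
rewrite (skew_mulEl y z) (skew_mulEr _ y) [RHS]skew_mul_suml [LHS]skew_mul_sumr.
apply/eq_bigr=> r _.
rewrite (skew_mulEr _ z) [RHS](skew_mulEr _ z) [LHS]skew_mul_sumr.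
by apply/eq_bigr=> u _; rewrite !skew_mulUU rmorphM ractM mulrA mulgA.
Qed.

Lemma skew_one_neq0 : skew_one != 0.
Proof. by rewrite monalgU_eq0 oner_neq0. Qed.

HB.instance Definition _ := GRing.Zmodule_isNzRing.Build T
  skew_mulA skew_mul1l skew_mul1r skew_mulDl skew_mulDr skew_one_neq0.

Definition skew_grading (a : G) : set T :=
  [set << f *g a >> | f in [set: S]].

End SkewRing.

Arguments skew_grading {G S} th a _.

HB.mixin Record isSigmaDerivation (R : nzRingType) (sigma : {rmorphism R -> R})
    (delta : R -> R) := {
  sder_additive : {morph delta : r s / r + s};
  sderM : forall r s, delta (r * s) = delta r * s + sigma r * delta s
}.

#[short(type="sigmaDerivation")]
HB.structure Definition SigmaDerivation (R : nzRingType)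
    (sigma : {rmorphism R -> R}) :=
  { delta of isSigmaDerivation R sigma delta }.

Definition inner_derivation (R : nzRingType) (sigma : {rmorphism R -> R})
    (delta : sigmaDerivation sigma) : Prop :=
  exists u : R, forall r, delta r = u * r - sigma r * u.

(* R[t; sigma, delta]: the polynomial sum_n r_n X^n stands for sum_n r_n t^n.
   ore_t is left multiplication by t, which the rule
   t r = sigma(r) t + delta(r) determines. *)
Definition ore (R : nzRingType) (sigma : {rmorphism R -> R})
  (delta : sigmaDerivation sigma) : Type := {poly R}.

Definition ore_t (R : nzRingType) (sigma : {rmorphism R -> R})
    (delta : sigmaDerivation sigma) (p : {poly R}) : {poly R} :=
  map_poly sigma p * 'X + map_poly delta p.

HB.lock Definition ore_mul (R : nzRingType) (sigma : {rmorphism R -> R})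
    (delta : sigmaDerivation sigma) (p q : {poly R}) : {poly R} :=
  \sum_(i < size p) p`_i *: iter i (ore_t delta) q.

Section Ore.
Variables (R : nzRingType) (sigma : {rmorphism R -> R}).
Variable delta : sigmaDerivation sigma.
Local Notation T := (ore delta).
Implicit Types p q : {poly R}.

HB.instance Definition _ := GRing.Zmodule.on T.

Local Notation ore_t := (ore_t delta).
Local Notation ore_mul := (@ore_mul R sigma delta).

Lemma sder0 : delta 0 = 0.
Proof. by apply: (addrI (delta 0)); rewrite -sder_additive !addr0. Qed.

Lemma sder1 : delta 1 = 0.
Proof.
by apply: (addrI (delta 1)); rewrite addr0 -{3}[1]mulr1 sderM rmorph1 mulr1 mul1r.
Qed.

Lemma coef_ore_t p i :
  (ore_t p)`_i = (if i is j.+1 then sigma p`_j else 0) + delta p`_i.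
Proof.
rewrite coefD coefMX !coef_map_id0 ?rmorph0 ?sder0 //.
by case: i.
Qed.

Lemma ore_tD p q : ore_t (p + q) = ore_t p + ore_t q.
Proof.
apply/polyP=> i; rewrite coefD !coef_ore_t !coefD sder_additive addrACA.
by case: i => [|i]; rewrite ?addr0 // coefD rmorphD.
Qed.

Lemma ore_t0 : ore_t 0 = 0.
Proof. by apply: (addrI (ore_t 0)); rewrite -ore_tD !addr0. Qed.

Lemma iter_tD n p q : iter n ore_t (p + q) = iter n ore_t p + iter n ore_t q.
Proof. by elim: n => //= n ->; rewrite ore_tD. Qed.

Lemma iter_t0 n : iter n ore_t 0 = 0.
Proof. by elim: n => //= n ->; rewrite ore_t0. Qed.

Lemma ore_tZ r p : ore_t (r *: p) = sigma r *: ore_t p + delta r *: p.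
Proof.
apply/polyP=> i; rewrite coef_ore_t [RHS]coefD !coefZ !coef_ore_t sderM mulrDr.
case: i => [|i]; first by rewrite mulr0 !add0r addrC.
by rewrite coefZ rmorphM -addrA; congr (_ + _); rewrite addrC.
Qed.

Lemma ore_tXn n : ore_t 'X^n = 'X^(n.+1).
Proof.
apply/polyP=> i; rewrite coef_ore_t !coefXn.
have D (b : bool) : delta b%:R = 0 :> R by case: b; rewrite ?sder0 ?sder1.
by case: i => [|i]; rewrite ?coefXn D addr0 // rmorph_nat eqSS.
Qed.

Lemma iter_t1 n : iter n ore_t 1 = 'X^n.
Proof. by elim: n => [|n IH]; rewrite ?expr0 //= IH ore_tXn. Qed.

Lemma ore_mulw n p q : (size p <= n)%N ->
  ore_mul p q = \sum_(i < n) p`_i *: iter i ore_t q.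
Proof.
move=> le; rewrite ore_mul.unlock (big_ord_widen n (fun i => p`_i *: iter i ore_t q)) //.
rewrite big_mkcond; apply: eq_bigr => i _; case: ltnP => // h.
by rewrite nth_default // scale0r.
Qed.

Lemma ore_mulDl : left_distributive ore_mul +%R.
Proof.
move=> p q r; pose n := maxn (size p) (size q).
rewrite (@ore_mulw n p) ?leq_maxl // (@ore_mulw n q) ?leq_maxr //.
rewrite (@ore_mulw n) ?size_polyD // -big_split.
by apply: eq_bigr => i _; rewrite coefD scalerDl.
Qed.

Lemma ore_mulDr : right_distributive ore_mul +%R.
Proof.
move=> p q r; rewrite ore_mul.unlock -big_split.
by apply: eq_bigr => i _; rewrite iter_tD scalerDr.
Qed.

Lemma ore_mul1l : left_id 1 ore_mul.
Proof. by move=> p; rewrite ore_mul.unlock size_poly1 big_ord1 coef1 scale1r. Qed.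

Lemma ore_mul1r : right_id 1 ore_mul.
Proof.
move=> p; rewrite ore_mul.unlock -[RHS]coefK poly_def.
by apply: eq_bigr => i _; rewrite iter_t1.
Qed.

Lemma ore_mul0l q : ore_mul 0 q = 0.
Proof. by rewrite ore_mul.unlock size_poly0 big_ord0. Qed.

Lemma ore_mulZl r p q : ore_mul (r *: p) q = r *: ore_mul p q.
Proof.
rewrite (@ore_mulw (size p)) ?size_scale_leq // ore_mul.unlock scaler_sumr.
by apply: eq_bigr => i _; rewrite coefZ scalerA.
Qed.

Lemma ore_mul_t p q : ore_mul (ore_t p) q = ore_t (ore_mul p q).
Proof.
have le : (size (ore_t p) <= (size p).+1)%N.
  apply/leq_sizeP => i hi; rewrite coef_ore_t nth_default ?(ltnW hi) // sder0.
  by case: i hi => [|i] hi; rewrite ?nth_default ?rmorph0 ?addr0.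
rewrite (ore_mulw _ le) [in RHS]ore_mul.unlock.
under eq_bigr do rewrite coef_ore_t scalerDl.
rewrite big_split /= big_ord_recl /= scale0r add0r.
rewrite big_ord_recr /= nth_default // sder0 scale0r addr0 -big_split /=.
rewrite (big_morph _ ore_tD ore_t0).
by apply: eq_bigr => i _; rewrite ore_tZ.
Qed.

Lemma ore_mulA : associative ore_mul.
Proof.
move=> p q r; rewrite [LHS](@ore_mulw (size p)) //.
rewrite [ore_mul p q](@ore_mulw (size p)) //.
rewrite (big_morph (ore_mul^~ r) (fun a b => ore_mulDl a b r) (ore_mul0l r)).
apply: eq_bigr => i _; rewrite ore_mulZl; congr (_ *: _).
by elim: (i : nat) => //= n IH; rewrite IH ore_mul_t.
Qed.

HB.instance Definition _ := GRing.Zmodule_isNzRing.Build T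
  ore_mulA ore_mul1l ore_mul1r ore_mulDl ore_mulDr (oner_neq0 {poly R}).

Definition ore_const (r : R) : T := (r%:P : {poly R}).
Definition ore_var : T := ('X : {poly R}).

Lemma ore_commutation (r : R) :
  ore_var * ore_const r = ore_const (sigma r) * ore_var + ore_const (delta r).
Proof.
change (ore_mul 'X r%:P = ore_mul (sigma r)%:P 'X + (delta r)%:P).
rewrite (@ore_mulw 1 _%:P) ?size_polyC_leq1 // big_ord1 coefC /= -mul_polyC.
rewrite ore_mul.unlock size_polyX big_ord_recl big_ord1 !coefX /= scale0r scale1r.
rewrite add0r /ore_t map_polyC; congr (_ + _); apply/polyP=> i.
by rewrite coef_map_id0 ?sder0 // !coefC; case: eqP; rewrite ?sder0.
Qed.

End Ore.

Section Ideals.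
Variable A : nzRingType.

Definition two_sided_ideal (I : set A) : Prop :=
  [/\ I 0, (forall x y, I x -> I y -> I (x + y)),
      (forall a x, I x -> I (a * x)) & (forall a x, I x -> I (x * a))].

Definition generated_ideal (X : set A) : set A :=
  [set x | forall I, two_sided_ideal I -> X `<=` I -> I x].

Definition simple_ring : Prop :=
  forall I, two_sided_ideal I -> I = [set 0] \/ I = [set: A].

(* The family of homogeneous components of A. *)
Variables (G : groupType) (grading : G -> set A).

Definition homogeneous (x : A) : Prop := exists a, grading a x.

Definition graded_ideal (I : set A) : Prop :=
  exists2 X : set A, X `<=` homogeneous & I = generated_ideal X.

Definition gr_simple : Prop :=
  forall I, graded_ideal I -> I = [set 0] \/ I = [set: A].

End Ideals.

Definition graded_ring_iso (G : groupType) (A B : nzRingType)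
    (grA : G -> set A) (grB : G -> set B) (f : {rmorphism A -> B}) : Prop :=
  bijective f /\ forall a, f @` grA a = grB a.

Definition triv_action (G : groupType) (S : nzRingType) : ring_action G S :=
  @RingAction G S (fun _ => idfun) (fun _ => erefl) (fun _ _ _ => erefl).

(* With the trivial action, (a u_t)(b u_r) = (a b) u_(t r). *)
Definition group_algebra (k : fieldType) (G : groupType) : Type :=
  skew_ring (triv_action G k).

HB.lock Definition lin_ext (k : fieldType) (G : groupType) (V : lmodType k)
    (f : G -> V) (x : {malg k[G]}) : V :=
  \sum_(t <- msupp x) x@_t *: f t.

Section GroupAlgebra.
Variables (k : fieldType) (G : groupType).
Local Notation kG := (group_algebra k G).

HB.instance Definition _ := GRing.Lmodule.on kG.
HB.instance Definition _ := GRing.NzRing.on kG.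

Definition gelt (t : G) : kG := << 1 *g t >>.

Lemma geltM (t r : G) : gelt (t * r)%g = gelt t * gelt r.
Proof. by rewrite [RHS]skew_mulUU /= mulr1. Qed.

Lemma gelt1 : gelt 1%g = 1. Proof. by []. Qed.

Lemma scale_gelt (a : k) t : a *: gelt t = (<< a *g t >> : {malg k[G]}).
Proof.
by apply/malgP=> r; rewrite [LHS]mcoeffZ !mcoeffU mulrnAr mulr1.
Qed.

Lemma ga_decomp (x : kG) : x = lin_ext gelt x.
Proof.
rewrite [LHS](monalgE (x : {malg k[G]})).
by rewrite lin_ext.unlock; apply: eq_bigr => t _; rewrite scale_gelt.
Qed.

Lemma lin_extw (V : lmodType k) (f : G -> V) (x : kG) (d : {fset G}) :
  (msupp (x : {malg k[G]}) `<=` d)%fset ->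
  lin_ext f x = \sum_(t <- d) (x : {malg k[G]})@_t *: f t.
Proof.
move=> le; rewrite lin_ext.unlock (big_fset_incl _ le) // => t _ /mcoeff_outdom ->.
by rewrite scale0r.
Qed.

Lemma lin_ext_linear (V : lmodType k) (f : G -> V) : linear (lin_ext f).
Proof.
move=> a x y; set d := (msupp (x : {malg k[G]}) `|`
  (msupp (y : {malg k[G]}) `|` msupp (a *: x + y : {malg k[G]})))%fset.
have lex : (msupp (x : {malg k[G]}) `<=` d)%fset by apply: fsubsetUl.
have ley : (msupp (y : {malg k[G]}) `<=` d)%fset.
  by apply: fsubset_trans (fsubsetUr _ _); apply: fsubsetUl.
have lexy : (msupp (a *: x + y : {malg k[G]}) `<=` d)%fset.
  by apply: fsubset_trans (fsubsetUr _ _); apply: fsubsetUr.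
rewrite (lin_extw f lex) (lin_extw f ley) (lin_extw f lexy) scaler_sumr.
rewrite -big_split; apply: eq_bigr => t _ /=.
by rewrite mcoeffD mcoeffZ scalerDl scalerA.
Qed.
HB.instance Definition _ (V : lmodType k) (f : G -> V) :=
  GRing.isLinear.Build k kG V *:%R (lin_ext f) (lin_ext_linear f).

Lemma lin_ext_gelt (V : lmodType k) (f : G -> V) t : lin_ext f (gelt t) = f t.
Proof.
have le : (msupp (gelt t : {malg k[G]}) `<=` [fset t])%fset.
  exact: msuppU_le.
by rewrite (lin_extw f le) big_seq_fset1 mcoeffUU scale1r.
Qed.

Lemma ga_scalerAl (a : k) (x y : kG) : a *: (x * y) = (a *: x) * y.
Proof.
have E z : a *: z = ((<< a *g 1%g >> : {malg k[G]}) : kG) * z.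
  rewrite (ga_decomp z) lin_ext.unlock scaler_sumr mulr_sumr; apply: eq_bigr => t _.
  by rewrite !scalerA !scale_gelt [RHS]skew_mulUU mul1g.
by rewrite !E mulrA.
Qed.
HB.instance Definition _ :=
  GRing.Lmodule_isLalgebra.Build k kG ga_scalerAl.

Lemma ga_scalerAr (a : k) (x y : kG) : a *: (x * y) = x * (a *: y).
Proof.
rewrite (ga_decomp x) lin_ext.unlock !mulr_suml scaler_sumr; apply: eq_bigr => t _.
rewrite (ga_decomp y) lin_ext.unlock [in RHS]scaler_sumr !mulr_sumr [LHS]scaler_sumr.
apply: eq_bigr => r _; rewrite scalerA !scale_gelt.
rewrite [X in _ *: X]skew_mulUU [RHS]skew_mulUU -!scale_gelt scalerA /=.
by rewrite mulrCA.
Qed.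
HB.instance Definition _ :=
  GRing.Lalgebra_isAlgebra.Build k kG ga_scalerAr.

End GroupAlgebra.

Section OreOfCocycle.
Variables (k : fieldType) (G : groupType).
Variable chi : UMagmaMorphism.type G (unit_group k).
Variables (gam : G) (c : Z1 chi).
Local Notation kG := (group_algebra k G).

Definition sigma_map : kG -> kG :=
  lin_ext (fun t => ugval (chi t) *: gelt k (gam * t * gam^-1)%g).
Definition delta_map : kG -> kG :=
  lin_ext (fun t => c t *: gelt k (gam * t)%g).

HB.instance Definition _ := GRing.Linear.on sigma_map.
HB.instance Definition _ := GRing.Linear.on delta_map.

Lemma sigma_lin a x y : sigma_map (a *: x + y) = a *: sigma_map x + sigma_map y.
Proof. exact: linearP. Qed.
Lemma delta_lin a x y : delta_map (a *: x + y) = a *: delta_map x + delta_map y.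
Proof. exact: linearP. Qed.

Lemma sigma_gelt t :
  sigma_map (gelt k t) = ugval (chi t) *: gelt k (gam * t * gam^-1)%g.
Proof. exact: lin_ext_gelt. Qed.
Lemma delta_gelt t : delta_map (gelt k t) = c t *: gelt k (gam * t)%g.
Proof. exact: lin_ext_gelt. Qed.

Lemma ga_bilinear_ind (P : kG -> kG -> Prop) :
  (forall x, P x 0) -> (forall y, P 0 y) ->
  (forall a x x' y, P x y -> P x' y -> P (a *: x + x') y) ->
  (forall a x y y', P x y -> P x y' -> P x (a *: y + y')) ->
  (forall t r, P (gelt k t) (gelt k r)) -> forall x y, P x y.
Proof.
move=> Px0 P0y Pl Pr Pg x y.
rewrite (ga_decomp x) lin_ext.unlock; elim: (enum_fset _) => [|t s IH].
  by rewrite big_nil.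
rewrite big_cons; apply: Pl => //.
rewrite (ga_decomp y) lin_ext.unlock; elim: (enum_fset _) => [|r s' IH'].
  by rewrite big_nil.
by rewrite big_cons; apply: Pr.
Qed.

Lemma ga_linl (a : k) (x x' y : kG) : (a *: x + x') * y = a *: (x * y) + x' * y.
Proof. by rewrite mulrDl ga_scalerAl. Qed.
Lemma ga_linr (a : k) (x y y' : kG) : x * (a *: y + y') = a *: (x * y) + x * y'.
Proof. by rewrite mulrDr ga_scalerAr. Qed.

Lemma sigma_monoid_morphism : GRing.monoid_morphism sigma_map.
Proof.
split; first by rewrite -gelt1 /sigma_map lin_ext_gelt gmulf1 /= scale1r mulg1 mulgV.
apply: ga_bilinear_ind => [x|y|a x x' y hx hx'|a x y y' hy hy'|t r].
- by rewrite !linear0 !mulr0 linear0.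
- by rewrite !linear0 !mul0r linear0.
- by rewrite ga_linl (sigma_lin a (x * y)) hx hx' (sigma_lin a x) ga_linl.
- by rewrite ga_linr (sigma_lin a (x * y)) hy hy' (sigma_lin a y) ga_linr.
rewrite -geltM /sigma_map !lin_ext_gelt -ga_scalerAl -ga_scalerAr scalerA -geltM.
by rewrite gmulfM !mulgA mulgVK.
Qed.
HB.instance Definition _ :=
  GRing.isMonoidMorphism.Build kG kG sigma_map sigma_monoid_morphism.

Definition sigma : {rmorphism kG -> kG} := sigma_map.

Lemma delta_additive : {morph delta_map : x y / x + y}.
Proof. exact: linearD. Qed.

Lemma deltaM x y : delta_map (x * y) = delta_map x * y + sigma x * delta_map y.
Proof.
move: x y; rewrite /sigma /=.
apply: ga_bilinear_ind => [x|y|a x x' y hx hx'|a x y y' hy hy'|t r].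
- by rewrite !linear0 !mulr0 linear0 addr0.
- by rewrite !linear0 !mul0r linear0 addr0.
- rewrite ga_linl (delta_lin a (x * y)) hx hx' (delta_lin a x) (sigma_lin a x).
  by rewrite !ga_linl scalerDr addrACA.
- rewrite ga_linr (delta_lin a (x * y)) hy hy' (delta_lin a y).
  by rewrite !ga_linr scalerDr addrACA.
rewrite -geltM /sigma_map /delta_map !lin_ext_gelt -!ga_scalerAl -!ga_scalerAr -!geltM.
by rewrite scalerA !mulgA mulgVK -scalerDl Z1E.
Qed.
HB.instance Definition _ :=
  isSigmaDerivation.Build kG sigma delta_map delta_additive deltaM.

Definition delta : sigmaDerivation sigma := delta_map.

Definition oreA : nzRingType := ore delta.

(* The component of degree a is the sum over n of k (a gam^-n) t^n. *)
Definition ore_grading (a : G) : set oreA :=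
  [set p | forall n, exists x : k,
     (p : {poly kG})`_n = x *: gelt k (a * gam ^- n)%g].

End OreOfCocycle.

Arguments ore_grading {k G chi} gam c a _.

Section AffineAction.
Variables (k : fieldType) (G : groupType).
Variables (chi : UMagmaMorphism.type G (unit_group k)) (c : Z1 chi).

Definition affine_subst (t : G) : {rmorphism {poly k} -> {poly k}} :=
  comp_poly (aff_poly (Phi c t)^-1%g).

Lemma affine_subst1 (f : {poly k}) : affine_subst 1%g f = f.
Proof. by rewrite /affine_subst gmulf1 invg1 aff_poly1 /= comp_polyXr. Qed.

Lemma affine_substM t r (f : {poly k}) :
  affine_subst (t * r)%g f = affine_subst t (affine_subst r f).
Proof.
by rewrite /affine_subst gmulfM invgM aff_polyM /= comp_polyA.
Qed.

Definition theta : ring_action G {poly k} :=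
  RingAction affine_subst1 affine_substM.

Definition Phi_orbit (K : fieldType) (iota : {rmorphism k -> K}) (x : K) : set K :=
  [set aff_act iota (Phi c t) x | t in [set: G]].

End AffineAction.

(* Main.v *)
Require Import Defs.
From HB Require Import structures.
From mathcomp Require Import all_boot all_algebra finmap.
From mathcomp.multinomials Require Import monalg.
From mathcomp Require Import boolp classical_sets functions cardinality.
From mathcomp Require Import ring.

Set Implicit Arguments.
Unset Strict Implicit.
Unset Printing Implicit Defensive.

Import GRing.Theory.
Local Open Scope classical_set_scope.
Local Open Scope ring_scope.

(** Everything is read off from the identification of the Ore extension [A]
    with the skew group ring [T] of [G] acting on [k[X]] by affine
    substitutions. In [A] the element [s = gam^-1 t] satisfies
    [s tau = tau (chi(tau) s + c(tau))], which is how [X] moves past [u_tau] in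
    [T]; so [t |-> u_gam X] extends [tau |-> u_tau] to a graded morphism
    [ore_to_skew]. It is bijective because the image of [t^n] is
    [q u_(gam^n)] with [q] of degree exactly [n] (imtX).

    Part (1) is a comparison of coefficients: in [v tau - sigma(tau) v] the
    coefficient of [gam tau] only involves the coefficient of [v] at [gam].

    For part (3), a graded ideal of [T] amounts to a [G]-stable ideal of [k[X]].
    Such an ideal, if proper and nonzero, has a nonconstant generator, whose
    roots form a finite stable set; conversely the polynomials that vanish on a
    finite orbit form a proper nonzero stable ideal (gr_simple_skewP). A finite
    orbit is the same thing as a point fixed by a subgroup [H] of finite index,
    and a fixed point of [H] is the same thing as a way to write the restriction
    of [c] to [H] as a coboundary (fixed_point_B1). In characteristic zero the
    average of a finite orbit is fixed by the whole of [G].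

    For part (4), [k[X]] is a module over [T]. If [Phi tau = 1], then
    [u_tau - 1] lies in its annihilator, a proper ideal; so simplicity forces
    [Phi] to be injective (simple_faithful). Conversely, if [Phi] is injective,
    the action on [k[X]] is faithful, and an element of minimal support shows
    that every nonzero ideal of [T] meets [k[X]] (contraction_neq0), so that
    gr-simplicity gives simplicity. Finally the affine group is metabelian. *)

(** * Simplicity through ideals that contain a nonzero element *)

Section IdealCriteria.
Variable A : nzRingType.
Implicit Types I : set A.

Lemma generated_ideal_two_sided (X : set A) :
  two_sided_ideal (generated_ideal X).
Proof.
split=> [I [] //|x y Ix Iy I idI XI|a x Ix I idI XI|a x Ix I idI XI].
- by case: (idI) => _ + _ _; apply; [apply: Ix | apply: Iy].
- by case: (idI) => _ _ + _; apply; apply: Ix.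
- by case: (idI) => _ _ _; apply; apply: Ix.
Qed.

Lemma two_sided_ideal1 I : two_sided_ideal I -> I 1 -> I = [set: A].
Proof.
case=> _ _ Il _ I1; apply/seteqP; split=> // x _.
by rewrite -[x]mulr1; apply: Il.
Qed.

(** The two criteria below, unlike the definitions, only speak of one element
    at a time, and so go through a ring isomorphism without any computation of
    generated ideals. *)
Lemma simple_ringP : simple_ring A <->
  forall I x, two_sided_ideal I -> I x -> x <> 0 -> I 1.
Proof.
split=> [simA I x idI Ix x0|hA I idI].
  by case: (simA I idI) Ix => -> // /x0.
have [[x [Ix x0]]|nI] := pselect (exists x, I x /\ x <> 0).
  by right; apply: two_sided_ideal1 => //; apply: hA Ix x0.
left; apply/seteqP; split=> [x Ix|x ->]; last by case: idI.
by apply: contrapT => x0; apply: nI; exists x.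
Qed.

Variables (G : groupType) (grading : G -> set A).

Lemma gr_simpleP : gr_simple grading <->
  forall I x, two_sided_ideal I -> homogeneous grading x -> I x -> x <> 0 ->
    I 1.
Proof.
split=> [simA I x idI hx Ix x0|hA _ [X hX ->]].
  have gx : graded_ideal grading (generated_ideal [set x]).
    by exists [set x] => // y ->.
  have xx : generated_ideal [set x] x by move=> J _; apply.
  case: (simA _ gx) => e; first by move: xx; rewrite e => /x0.
  have : generated_ideal [set x] 1 by rewrite e.
  by apply=> // y ->.
have idX := generated_ideal_two_sided X.
have [[x [Xx x0]]|nX] := pselect (exists x, X x /\ x <> 0).
  right; apply: two_sided_ideal1 => //; apply: (hA _ x) => //.
    exact: hX.
  by move=> J _; apply.
left; apply/seteqP; split=> [x|x ->]; last by case: idX.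
apply=> [|y Xy]; last by apply: contrapT => y0; apply: nX; exists y.
by split=> [//|y z -> ->|a y ->|a y ->]; rewrite /= ?addr0 ?mulr0 ?mul0r.
Qed.

End IdealCriteria.

Section IdealTransfer.
Variables (A B : nzRingType) (f : {rmorphism A -> B}).

Lemma preimage_two_sided (J : set B) :
  two_sided_ideal J -> two_sided_ideal (f @^-1` J).
Proof.
case=> J0 JD Jl Jr; split=> [|x y|a x|a x]; rewrite /= ?raddf0 //.
- by rewrite raddfD; apply: JD.
- by rewrite rmorphM; apply: Jl.
- by rewrite rmorphM; apply: Jr.
Qed.

Lemma image_two_sided (I : set A) : (forall y, exists x, f x = y) ->
  two_sided_ideal I -> two_sided_ideal (f @` I).
Proof.
move=> surj [I0 ID Il Ir]; split.
- by exists 0; rewrite ?raddf0.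
- by move=> _ _ [x Ix <-] [y Iy <-]; exists (x + y); rewrite ?raddfD //; apply: ID.
- move=> b _ [x Ix <-]; have [a <-] := surj b.
  by exists (a * x); rewrite ?rmorphM //; apply: Il.
- move=> b _ [x Ix <-]; have [a <-] := surj b.
  by exists (x * a); rewrite ?rmorphM //; apply: Ir.
Qed.

Hypothesis fbij : bijective f.

Let fsurj y : exists x, f x = y.
Proof. by case: fbij => g _ gK; exists (g y). Qed.

Lemma iso_simple : simple_ring A <-> simple_ring B.
Proof.
have finj := bij_inj fbij; rewrite !simple_ringP; split=> [hA J y idJ|hB I x idI Ix x0].
  have [x <-] := fsurj y => Jx x0; rewrite -(rmorph1 f).
  by apply: (hA _ x (preimage_two_sided idJ)) => // e; apply: x0; rewrite e raddf0.
have [||y Iy] := hB _ (f x) (image_two_sided fsurj idI); first by exists x.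
  by rewrite -(raddf0 f) => /finj.
by rewrite -(rmorph1 f) => /finj <-.
Qed.

Variables (G : groupType) (grA : G -> set A) (grB : G -> set B).
Hypothesis fgr : forall a, f @` grA a = grB a.

Lemma iso_gr_simple : gr_simple grA <-> gr_simple grB.
Proof.
have finj := bij_inj fbij; rewrite !gr_simpleP; split=> [hA J y idJ|hB I x idI].
  move=> [a]; rewrite -fgr => -[x hx <-] Jx x0; rewrite -(rmorph1 f).
  apply: (hA _ x (preimage_two_sided idJ)) => //; first by exists a.
  by move=> e; apply: x0; rewrite e raddf0.
move=> [a hx] Ix x0.
have [|||y Iy] := hB _ (f x) (image_two_sided fsurj idI).
- by exists a; rewrite -fgr; exists x.
- by exists x.
- by rewrite -(raddf0 f) => /finj.
by rewrite -(rmorph1 f) => /finj <-.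
Qed.

End IdealTransfer.

(** * Cocycles, fixed points and finite orbits *)

Lemma H1_class_eq0 (k : fieldType) (G : groupType)
    (chi : UMagmaMorphism.type G (unit_group k)) (c : Z1 chi) :
  H1_class c = 0 <-> c \in B1 chi.
Proof.
rewrite -[in X in _ <-> X](subr0 c) Quotient.idealrBE.
have -> : 0 = (\pi_(Quotient.quot (B1 chi)) 0)%qT :> H1 chi.
  by rewrite -pi_zeror.
by split=> [/eqP|/eqP].
Qed.

Definition group_of_closed (G : groupType) (S : {pred G})
    (hS : group_closed S) : groupClosed G :=
  GroupClosed.Pack (GroupClosed.Class
    (isInvClosed.Build G S (group_closedV hS))
    (isMul1Closed.Build G S (proj1 hS))
    (isMulClosed.Build G S (group_closedM hS))).

Section AffineAction.
Variables (k K : fieldType) (iota : {rmorphism k -> K}).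

Lemma aff_act1 x : aff_act iota 1%g x = x.
Proof. by rewrite /aff_act /= !rmorph1 mul1r rmorph0 addr0. Qed.

Lemma aff_actM p q x :
  aff_act iota (p * q)%g x = aff_act iota p (aff_act iota q x).
Proof. by rewrite /aff_act /= rmorphM rmorphD rmorphM mulrDr mulrA addrA. Qed.

Variables (G : groupType) (chi : UMagmaMorphism.type G (unit_group k)).
Variable c : Z1 chi.
Local Notation act t x := (aff_act iota (Phi c t) x).

Lemma act1 x : act 1%g x = x.
Proof. by rewrite gmulf1 aff_act1. Qed.

Lemma actM t r x : act (t * r)%g x = act t (act r x).
Proof. by rewrite gmulfM aff_actM. Qed.

Lemma actK t : cancel (fun x => act t x) (fun x => act t^-1%g x).
Proof. by move=> x; rewrite -actM mulVg act1. Qed.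

(** A common fixed point [x] satisfies [c t = x (1 - chi t)]; so [x] lies in
    [k] as soon as some [chi t] differs from [1], and otherwise [c = 0]. *)
Lemma fixed_point_B1 x : (forall t, act t x = x) -> c \in B1 chi.
Proof.
move=> fx; have cE t : iota (c t) = x * (1 - iota (ugval (chi t))).
  by rewrite mulrBr mulr1 (mulrC x) -[X in X - _](fx t) addrAC subrr add0r.
apply/asboolP; have [[t chit]|chi1] := pselect (exists t, ugval (chi t) <> 1).
  have d0 : 1 - ugval (chi t) != 0 by rewrite subr_eq0 eq_sym; apply/eqP.
  have xE : x = iota (c t / (1 - ugval (chi t))).
    rewrite fmorph_div rmorphB rmorph1 cE mulfK //.
    by rewrite -(rmorph1 iota) -rmorphB fmorph_eq0.
  exists (- (c t / (1 - ugval (chi t)))) => r; apply: (fmorph_inj iota).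
  by rewrite rmorphM rmorphN -xE cE rmorphB rmorph1 mulNr -mulrN opprB.
exists 0 => r; rewrite mul0r; apply: (fmorph_inj iota).
have [|chir] := eqVneq (ugval (chi r)) 1; last by case: chi1; exists r; apply/eqP.
by rewrite cE rmorph0 => ->; rewrite rmorph1 subrr mulr0.
Qed.

Lemma B1_fixed_point : c \in B1 chi -> exists x, forall t, act t x = x.
Proof.
move=> /asboolP[x cE]; exists (iota (- x)) => t; rewrite /aff_act /= cE.
by rewrite -rmorphM -rmorphD mulrN addrC mulrBr mulr1 mulrC addrAC subrr add0r.
Qed.

(** The group permutes the orbit by affine maps, and these preserve averages;
    characteristic zero is what allows dividing by the size of the orbit. *)
Lemma finite_orbit_fixed_point x : [pchar k] =i pred0 ->
  finite_set (Phi_orbit c iota x) -> exists y, forall t, act t y = y.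
Proof.
move=> /pcharf0P char0 fin; set F := fset_set (Phi_orbit c iota x).
have FE y : (y \in F) = (y \in Phi_orbit c iota x) by rewrite in_fset_set.
have Fstable t : [fset act t y | y in F]%fset = F.
  apply/fsetP => y; apply/imfsetP/idP => [[z /= zF ->]|].
    move: zF; rewrite !FE !inE => -[r _ <-]; exists (t * r)%g => //.
    by rewrite actM.
  rewrite FE inE => -[r _ <-]; exists (act (t^-1 * r)%g x).
    by rewrite /= FE inE; exists (t^-1 * r)%g.
  by rewrite -actM mulgA mulgV mul1g.
set n := #|` F|; have n0 : (n%:R : K) != 0.
  rewrite -(rmorph_nat iota) fmorph_eq0 char0 -lt0n cardfs_gt0.
  by apply/fset0Pn; exists x; rewrite FE inE; exists 1%g => //; rewrite act1.
exists ((\sum_(y <- F) y) / n%:R) => t.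
have sumE : \sum_(y <- F) y =
    iota (ugval (chi t)) * \sum_(y <- F) y + iota (c t) * n%:R.
  rewrite -{1}(Fstable t) big_imfset /=; last first.
    by move=> y z _ _; apply: (can_inj (actK t)).
  by rewrite big_split mulr_sumr big_const_seq count_predT iter_addr addr0 mulr_natr.
by rewrite [in RHS]sumE mulrDl mulfK // -mulrA.
Qed.

Definition fixes x : {pred G} := fun t => act t x == x.

Lemma fixes_closed x : group_closed (fixes x).
Proof.
split=> [|t r]; first by apply/eqP; rewrite act1.
move=> /eqP tx /eqP rx; apply/eqP; rewrite actM -{1}rx.
by rewrite actK tx.
Qed.
Definition stab x := group_of_closed (fixes_closed x).

Lemma finite_orbit_stab x :
  finite_set (Phi_orbit c iota x) -> finite_index (stab x).
Proof.
move=> fin; rewrite /finite_index.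
have -> : [set lcoset_of (stab x) g | g in [set: G]] =
    (fun y => [set g | act g x = y]) @` Phi_orbit c iota x.
  (* The coset of [g] is the fibre of the orbit map over [act g x]. *)
  have cosetE g : lcoset_of (stab x) g = [set h | act h x = act g x].
    apply/seteqP; split=> [_ [n /= /eqP nx <-]|h /= hx]; first by rewrite /= actM nx.
    exists (g^-1 * h)%g; last by rewrite mulgA mulgV mul1g.
    by apply/eqP; rewrite actM hx actK.
  rewrite /Phi_orbit image_comp; apply/seteqP.
  by split=> _ [g _ <-]; exists g => //=; rewrite cosetE.
exact: finite_image.
Qed.

(** If [H] fixes [x], the orbit map factors through the cosets of [H]. *)
Lemma finite_index_orbit (H : groupClosed G) x : finite_index H ->
  (forall t, t \in H -> act t x = x) -> finite_set (Phi_orbit c iota x).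
Proof.
move=> fin fx; apply: sub_finite_set (finite_image (fun C =>
  xget x [set act g x | g in C]) fin) => _ [g _ <-].
exists (lcoset_of H g); first by exists g.
have -> : [set act h x | h in lcoset_of H g] = [set act g x].
  apply/seteqP; split=> [_ [_ [n nH <-] <-]|_ ->] /=; first by rewrite actM fx.
  exists g => //; exists 1%g; last by rewrite mulg1.
  by rewrite /= gpred1.
by case: xgetP => [y _ -> //|/(_ (act g x)) []].
Qed.

End AffineAction.

Section OrbitsCocycles.
Variables (k K : fieldType) (iota : {rmorphism k -> K}).
Variables (G : groupType) (chi : UMagmaMorphism.type G (unit_group k)).
Variable c : Z1 chi.

(** The stabilizer of a point with finite orbit has finite index, and on it the
    cocycle is the coboundary given by that point. *)
Lemma finite_orbit_res :
  (forall x : K, ~ finite_set (Phi_orbit c iota x)) <->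
  (forall H : groupClosed G, finite_index H -> H1_class (res_cocycle H c) <> 0).
Proof.
split=> [inf H finH /H1_class_eq0 /(B1_fixed_point iota)[x fx]|nz x fin].
  apply: (inf x); apply: (finite_index_orbit finH) => t tH.
  exact: (fx (Subgroup tH)).
apply: (nz (stab iota c x)); first exact: finite_orbit_stab.
apply/H1_class_eq0/(@fixed_point_B1 _ _ iota _ _ _ x) => -[t tx].
exact/eqP.
Qed.

Lemma finite_orbit_pchar0 : [pchar k] =i pred0 ->
  (forall x : K, ~ finite_set (Phi_orbit c iota x)) <-> H1_class c <> 0.
Proof.
move=> char0; split=> [inf /H1_class_eq0 /(B1_fixed_point iota)[x fx]|nz x fin].
  apply: (inf x); apply: sub_finite_set (finite_set1 x) => _ [t _ <-].
  exact: fx.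
apply/nz/H1_class_eq0.
by have [y] := finite_orbit_fixed_point char0 fin; apply: fixed_point_B1.
Qed.

End OrbitsCocycles.

(** * Ideals of skew group rings *)

Section SkewIdeals.
Variables (G : groupType) (S : idomainType) (th : ring_action G S).
Local Notation T := (skew_ring th).
Implicit Types (x y : T) (f s : S) (t r g : G).

Definition sU f t : T := (<< f *g t >> : {malg S[G]}).
Definition scoef x t : S := (x : {malg S[G]})@_t.

Lemma skewP x y : (forall t, scoef x t = scoef y t) -> x = y.
Proof. by move=> e; apply/malgP. Qed.

Lemma scoefD x y t : scoef (x + y) t = scoef x t + scoef y t.
Proof. exact: mcoeffD. Qed.

Lemma scoefB x y t : scoef (x - y) t = scoef x t - scoef y t.
Proof. exact: mcoeffB. Qed.

Lemma scoef0 t : scoef 0 t = 0.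
Proof. exact: mcoeff0. Qed.

Lemma scoef_sum I (s : seq I) (F : I -> T) t :
  scoef (\sum_(i <- s) F i) t = \sum_(i <- s) scoef (F i) t.
Proof. exact: (big_morph (scoef^~ t) (fun x y => scoefD x y t) (scoef0 t)). Qed.

Lemma scoefU f t r : scoef (sU f t) r = f *+ (t == r).
Proof. exact: mcoeffU. Qed.

Lemma scoef1 t : scoef 1 t = 1 *+ (1%g == t).
Proof. exact: scoefU. Qed.

Lemma sUM f s t r : sU f t * sU s r = sU (f * th t s) (t * r)%g.
Proof. exact: skew_mulUU. Qed.

Lemma sUD f s t : sU (f + s) t = sU f t + sU s t.
Proof. exact: monalgUD. Qed.

Lemma skew_sum x : x = \sum_(t <- msupp (x : {malg S[G]})) sU (scoef x t) t.
Proof. exact: monalgE. Qed.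

Lemma scoefUl f t x g : scoef (sU f t * x) g = f * th t (scoef x (t^-1 * g)%g).
Proof.
rewrite [in LHS](skew_sum x) mulr_sumr scoef_sum.
rewrite [in RHS](skew_sum x) scoef_sum rmorph_sum mulr_sumr.
apply: eq_bigr => r _; rewrite sUM !scoefU rmorphMn mulrnAr.
by congr (_ *+ _); congr nat_of_bool; apply/eqP/eqP => [<-|->]; rewrite ?mulKg ?mulVKg.
Qed.

Lemma scoefUr f t x g :
  scoef (x * sU f t) g = scoef x (g * t^-1)%g * th (g * t^-1)%g f.
Proof.
rewrite [in LHS](skew_sum x) mulr_suml scoef_sum.
rewrite [in RHS](skew_sum x) scoef_sum mulr_suml.
apply: eq_bigr => r _; rewrite sUM !scoefU mulrnAl.
have -> : (r * t == g)%g = (r == g * t^-1)%g.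
  by apply/eqP/eqP => [<-|->]; rewrite ?mulgK ?mulgVK.
by case: eqP => // ->.
Qed.

(** Multiplication by [f u_t] on either side permutes the coefficients, up to
    the action and multiplication in [S]; this makes the condition on the
    coefficients two-sided. *)
Lemma coef_ideal (J : set S) : two_sided_ideal J ->
  (forall t f, J f -> J (th t f)) ->
  two_sided_ideal [set x : T | forall t, J (scoef x t)].
Proof.
move=> [J0 JD Jl Jr] Jth.
have Jsum I (s : seq I) (F : I -> S) : (forall i, J (F i)) -> J (\sum_(i <- s) F i).
  by move=> JF; elim/big_ind: _ => //; apply: JD.
split=> [t|x y Jx Jy t|a x Jx t|a x Jx t] /=.
- by rewrite scoef0.
- by rewrite scoefD; apply: JD.
- rewrite (skew_sum a) mulr_suml scoef_sum; apply: Jsum => r.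
  by rewrite scoefUl; apply/Jl/Jth.
- rewrite (skew_sum a) mulr_sumr scoef_sum; apply: Jsum => r.
  by rewrite scoefUr; apply: Jr.
Qed.

Section ContractedIdeal.
Variable I : set T.
Hypothesis idI : two_sided_ideal I.

Definition contraction : set S := [set f | I (sU f 1%g)].

Lemma contraction_two_sided : two_sided_ideal contraction.
Proof.
case: idI => I0 ID Il Ir; split=> [|f s If Is|s f If|s f If]; rewrite /contraction /=.
- by rewrite /sU monalgU0.
- by rewrite sUD; apply: ID.
- have -> : sU (s * f) 1%g = sU s 1%g * sU f 1%g by rewrite sUM ract1 mulg1.
  exact: Il.
- have -> : sU (f * s) 1%g = sU f 1%g * sU s 1%g by rewrite sUM ract1 mulg1.
  exact: Ir.
Qed.

Lemma contraction_stable t f : contraction f -> contraction (th t f).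
Proof.
case: idI => _ _ Il Ir If; rewrite /contraction /=.
have -> : sU (th t f) 1%g = sU 1 t * sU f 1%g * sU 1 t^-1%g.
  by rewrite !sUM mul1r rmorph1 mulr1 mulg1 mulgV.
by apply/Ir/Il.
Qed.

Lemma contractionU f t : I (sU f t) -> contraction f.
Proof.
case: idI => _ _ Il Ir If; rewrite /contraction /=.
have -> : sU f 1%g = sU f t * sU 1 t^-1%g by rewrite sUM rmorph1 mulr1 mulgV.
exact: Ir.
Qed.

(** Minimal support: if [x] has [t0] in its support then
    [s x - x (th t0^-1 s)] loses [t0], acquires no new support, and keeps any
    other [r] of the support as soon as [s] is moved by [r t0^-1]. *)
Lemma contraction_neq0 x :
  (forall t, t <> 1%g -> exists s, th t s <> s) ->
  I x -> x <> 0 -> exists2 f, contraction f & f != 0.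
Proof.
move=> faith; have [n] := ubnP #|` msupp (x : {malg S[G]})|.
elim: n x => // n IHn x /ltnSE le_n Ix /eqP x0.
have /fset0Pn[t0 xt0] : msupp (x : {malg S[G]}) != fset0.
  apply: contraNneq x0 => supp0; apply/eqP/skewP => t.
  by rewrite scoef0; apply: mcoeff_outdom; rewrite supp0 inE.
have xt0n : scoef x t0 != 0 by rewrite /scoef mcoeff_neq0.
case: (idI) => _ ID Il Ir.
have [[r [xr rt0]]|single] :=
    pselect (exists r, r \in msupp (x : {malg S[G]}) /\ r <> t0); last first.
  have xE : x = sU (scoef x t0) t0.
    apply: skewP => r; rewrite scoefU; case: eqP => [<- //|/nesym rt0].
    apply/eqP; rewrite /scoef mcoeff_eq0; apply/negP => xr.
    by apply: single; exists r.
  by exists (scoef x t0) => //; apply: (@contractionU _ t0); rewrite -xE.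
have [|s srt] := faith (r * t0^-1)%g.
  by move=> /(congr1 (fun g => g * t0)%g); rewrite mulgVK mul1g.
pose z : T := sU s 1%g * x - x * sU (th t0^-1%g s) 1%g.
have zE t : scoef z t = scoef x t * (s - th (t * t0^-1)%g s).
  rewrite /z scoefB scoefUl scoefUr ract1 invg1 mul1g mulg1 -ractM.
  by rewrite mulrBr; congr (_ - _); rewrite mulrC.
have supz : (msupp (z : {malg S[G]}) `<=` msupp (x : {malg S[G]}) `\ t0)%fset.
  apply/fsubsetP => t; rewrite !inE -!mcoeff_neq0 -/(scoef z t) -/(scoef x t) zE.
  rewrite mulf_eq0 negb_or => /andP[-> st]; rewrite andbT.
  by apply: contraNneq st => ->; rewrite mulgV ract1 subrr.
apply: (IHn z).
- apply: leq_trans le_n; apply: leq_ltn_trans (fsubset_leq_card supz) _.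
  by rewrite [X in (_ < X)%N](cardfsD1 t0) xt0.
- by apply: ID; [apply: Il | rewrite -mulrN; apply: Ir].
move=> z0; have := zE r; rewrite z0 scoef0 => /esym/eqP.
rewrite mulf_eq0 /scoef mcoeff_eq0 xr /= subr_eq0 => /eqP e.
by apply: srt.
Qed.

End ContractedIdeal.

(** The natural module structure of [S] over its skew group ring; its
    annihilator is the ideal that detects the elements of [G] acting
    trivially. *)
Definition smod x s : S :=
  \sum_(t <- msupp (x : {malg S[G]})) scoef x t * th t s.

Lemma smodw (d : {fset G}) x s : (msupp (x : {malg S[G]}) `<=` d)%fset ->
  smod x s = \sum_(t <- d) scoef x t * th t s.
Proof.
move=> le; rewrite /smod (big_fset_incl _ le) // => t _ xt.
by rewrite /scoef mcoeff_outdom ?mul0r.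
Qed.

Lemma smodD x y s : smod (x + y) s = smod x s + smod y s.
Proof.
rewrite (smodw _ (msuppD_le _ _)) (smodw _ (fsubsetUl _ (msupp (y : {malg S[G]})))).
rewrite (smodw _ (fsubsetUr (msupp (x : {malg S[G]})) _)) -big_split.
by apply: eq_bigr => t _; rewrite scoefD mulrDl.
Qed.

Lemma smod0 s : smod 0 s = 0.
Proof. by rewrite /smod msupp0 big_seq_fset0. Qed.

Lemma smod_sum I (l : seq I) (F : I -> T) s :
  smod (\sum_(i <- l) F i) s = \sum_(i <- l) smod (F i) s.
Proof. exact: (big_morph (smod^~ s) (fun x y => smodD x y s) (smod0 s)). Qed.

Lemma smodU f t s : smod (sU f t) s = f * th t s.
Proof. by rewrite (smodw _ msuppU_le) big_seq_fset1 scoefU eqxx. Qed.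

Lemma smodB x y s : smod (x - y) s = smod x s - smod y s.
Proof. by apply/eqP; rewrite -subr_eq opprK -smodD subrK. Qed.

Lemma smodM x y s : smod (x * y) s = smod x (smod y s).
Proof.
rewrite [in LHS](skew_sum x) mulr_suml smod_sum.
apply: eq_bigr => t _.
rewrite [in LHS](skew_sum y) mulr_sumr smod_sum rmorph_sum mulr_sumr.
by apply: eq_bigr => r _; rewrite sUM smodU rmorphM ractM mulrA.
Qed.

Lemma smod_ker_ideal : two_sided_ideal [set x : T | forall s, smod x s = 0].
Proof.
have smodr0 x : smod x 0 = 0.
  by rewrite /smod big1 // => t _; rewrite rmorph0 mulr0.
split=> [s|x y kx ky s|a x kx s|a x kx s] /=.
- by rewrite smod0.
- by rewrite smodD kx ky addr0.
- by rewrite smodM kx smodr0.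
- by rewrite smodM kx.
Qed.

(** If [t] acts trivially then [u_t - 1] annihilates the module [S], whereas
    [1] does not. *)
Lemma simple_faithful t :
  simple_ring T -> (forall s, th t s = s) -> t = 1%g.
Proof.
move=> /simple_ringP simT tht; apply: contrapT => t1.
have smod1 s : smod 1 s = s by rewrite [LHS]smodU ract1 mul1r.
suff /(_ 1)/eqP : forall s, smod 1 s = 0 by rewrite smod1 oner_eq0.
apply: (simT _ (sU 1 t - 1) smod_ker_ideal) => [s|].
  by rewrite /= smodB smodU smod1 tht mul1r subrr.
move=> /(congr1 (scoef^~ t)); rewrite scoefB scoefU scoef1 scoef0 eqxx.
by case: eqP => [/esym //|_] /eqP; rewrite subr0 oner_eq0.
Qed.

(** A nonzero element of [S] in the ideal, as provided by faithfulness, is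
    homogeneous of degree [1], so the graded criterion applies to it. *)
Lemma simple_of_gr_simple : (forall t, t <> 1%g -> exists s, th t s <> s) ->
  gr_simple (skew_grading th) -> simple_ring T.
Proof.
move=> faith /gr_simpleP grT; apply/simple_ringP => I x idI Ix x0.
have [f If f0] := contraction_neq0 idI faith Ix x0.
apply: (grT I (sU f 1%g)) => //; first by exists 1%g, f.
by move=> /eqP; rewrite monalgU_eq0 (negPf f0).
Qed.

End SkewIdeals.

(** * Stable ideals of polynomials and finite orbits *)

Section PolyIdeal.
Variables (k : fieldType) (J : set {poly k}).
Hypothesis idJ : two_sided_ideal J.

Lemma poly_ideal_generator f : J f -> f != 0 ->
  exists d, [/\ J d, d != 0 & forall g, J g -> d %| g].
Proof.
move=> Jf f0; pose P n := `[< exists g, [/\ J g, g != 0 & size g = n] >].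
have exP : exists n, P n by exists (size f); apply/asboolP; exists f.
have [n /asboolP[d [Jd d0 <-]] dmin] := ex_minnP exP.
exists d; split=> // g Jg; apply/eqP; apply: contrapT => /eqP r0.
have Jr : J (g %% d).
  have -> : g %% d = g - (g %/ d) * d.
    by rewrite [X in X - _](divp_eq g d) addrAC subrr add0r.
  by case: idJ => _ JD Jl _; rewrite -mulNr; apply: JD => //; apply: Jl.
suff : (size d <= size (g %% d)%R)%N by rewrite leqNgt ltn_modp d0.
by apply/dmin/asboolP; exists (g %% d); split=> //; apply/eqP.
Qed.

End PolyIdeal.

Section AffineSkew.
Variables (k : fieldType) (K : closedFieldType) (iota : {rmorphism k -> K}).
Variables (G : groupType) (chi : UMagmaMorphism.type G (unit_group k)).
Variable c : Z1 chi.
Local Notation act t x := (aff_act iota (Phi c t) x).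
Local Notation "f ^iota" := (map_poly iota f) (at level 2).
Local Notation T := (skew_ring (theta c)).

Lemma horner_aff_poly p y : ((aff_poly p)^iota).[y] = aff_act iota p y.
Proof.
by rewrite /aff_poly rmorphD /= map_polyC map_polyZ map_polyX !hornerE.
Qed.

(** On points, the substitution [theta c t] is the inverse of [act t]. *)
Lemma horner_theta t f y : ((theta c t f)^iota).[y] = (f^iota).[act t^-1%g y].
Proof. by rewrite /= map_comp_poly horner_comp horner_aff_poly gmulfV. Qed.

Lemma aff_poly_inj : injective (@aff_poly k).
Proof.
move=> p q e; have := congr1 (fun f : {poly k} => f`_0) e.
have := congr1 (fun f : {poly k} => f`_1) e; move: p q {e} => [a x] [b y].
rewrite /aff_poly !coefD !coefZ !coefX !coefC /= !mulr1 !mulr0 !addr0 !add0r.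
by move=> ab ->; congr Aff; apply: val_inj.
Qed.

Lemma theta_faithful t : (forall f, theta c t f = f) <-> Phi c t = 1%g.
Proof.
split=> [thf|Pt f]; last by rewrite /= /affine_subst Pt invg1 aff_poly1 /= comp_polyXr.
apply: invg_inj; rewrite invg1; apply: aff_poly_inj; rewrite aff_poly1.
by rewrite -[RHS]thf /= comp_polyX.
Qed.

Lemma algebraic_annihilator (s : seq K) : (forall x, algebraicOver iota x) ->
  exists2 f : {poly k}, f != 0 & forall x, x \in s -> root (f^iota) x.
Proof.
move=> alg; elim: s => [|x s [f f0 fs]]; first by exists 1; rewrite ?oner_neq0.
have [g g0 gx] := alg x; exists (g * f); first by rewrite mulf_neq0.
move=> y; rewrite inE rmorphM /= rootM => /orP[/eqP ->|/fs ->]; last exact: orbT.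
by rewrite gx.
Qed.

(** A finite orbit gives the graded ideal of those elements whose coefficients
    vanish on the orbit. Conversely, the contraction to [k[X]] of a proper
    nonzero graded ideal is generated by some [d]; by stability the roots of
    [d] are permuted by the group, and there are finitely many of them. *)
Lemma gr_simple_skewP : (forall x, algebraicOver iota x) ->
  gr_simple (skew_grading (theta c)) <->
  (forall x : K, ~ finite_set (Phi_orbit c iota x)).
Proof.
move=> alg; rewrite gr_simpleP; split=> [grT x fin|inf I x idI [t [f _ fx]] Ix x0].
  pose J : set {poly k} := [set f | forall y, Phi_orbit c iota x y -> root (f^iota) y].
  have idJ : two_sided_ideal J.
    split=> [y _|f g Jf Jg y Oy|f g Jg y Oy|f g Jg y Oy] /=.
    - by rewrite rmorph0 root0.
    - by rewrite rmorphD rootE hornerD (eqP (Jf _ Oy)) (eqP (Jg _ Oy)) addr0.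
    - by rewrite rmorphM rootM Jg ?orbT.
    - by rewrite rmorphM rootM Jg.
  have Jth t f : J f -> J (theta c t f).
    move=> Jf _ [r _ <-]; rewrite rootE horner_theta -actM; apply: Jf.
    by exists (t^-1 * r)%g.
  (* [J] is nonzero because every point of the orbit is algebraic over [k]. *)
  have [f f0 fO] := algebraic_annihilator (fset_set (Phi_orbit c iota x)) alg.
  have Jf : J f by move=> y Oy; apply: fO; rewrite in_fset_set // inE.
  suff J1 : forall t, J (scoef (1 : T) t).
    have Ox : Phi_orbit c iota x x by exists 1%g; rewrite ?act1.
    by move: (J1 1%g x Ox); rewrite scoef1 eqxx rmorph1 rootE hornerC oner_eq0.
  apply: (grT _ (sU (theta c) f 1%g) (coef_ideal idJ Jth)).
  - by exists 1%g, f.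
  - by move=> r; rewrite scoefU; case: eqP => _ //; case: idJ.
  - by move/eqP; rewrite monalgU_eq0 (negPf f0).
have f0 : f != 0 by apply/eqP => f0; apply: x0; rewrite -fx f0 monalgU0.
have Jf : contraction I f by apply: (contractionU idI (t := t)); rewrite [sU _ _ _]fx.
have idJ := contraction_two_sided idI.
have [d [Jd d0 dJ]] := poly_ideal_generator idJ Jf f0.
have [|/closed_rootP[y dy]] := eqVneq (size (d^iota)) 1.
  rewrite size_map_poly => /eqP/size_poly1P[a a0 dE].
  case: idJ => _ _ Jl _; have := Jl (a^-1)%:P _ Jd.
  by rewrite dE -polyCM mulVf.
have [rs dE] := closed_field_poly_normal (d^iota).
have rsP z : root (d^iota) z -> z \in rs.
  rewrite dE rootZ ?root_prod_XsubC //.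
  by rewrite lead_coef_map fmorph_eq0 lead_coef_eq0.
case: (inf y); apply: sub_finite_set (finite_seq rs) => _ [r _ <-].
apply: rsP; have /dvdpP[q /(congr1 (map_poly iota))] :=
  dJ _ (contraction_stable idI r^-1%g Jd).
move=> /(congr1 (fun p => p.[y])); rewrite horner_theta invgK rmorphM hornerM /=.
by rewrite (eqP dy) mulr0 => e; apply/eqP.
Qed.

(** [Phi] is injective exactly when the action on [k[X]] is faithful. *)
Lemma simple_skewP : simple_ring T <->
  gr_simple (skew_grading (theta c)) /\ injective (Phi c).
Proof.
split=> [simT|[grT Pinj]]; last first.
  apply: simple_of_gr_simple grT => t t1; apply: contrapT => nex; apply: t1.
  apply: Pinj; rewrite gmulf1; apply/theta_faithful => f.
  by apply: contrapT => tf; apply: nex; exists f.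
split.
  apply/gr_simpleP => I x idI _ Ix x0.
  by have /simple_ringP := simT; apply; [exact: idI | exact: Ix |].
move=> t r Ptr; apply/eqP; rewrite -divg_eq1; apply/eqP.
apply: (simple_faithful simT); apply/theta_faithful.
by rewrite gmulfF /= Ptr mulgV.
Qed.

End AffineSkew.

(** * The Ore extension as a skew group ring *)

Section OreSkewIso.
Variables (k : fieldType) (G : groupType).
Variables (chi : UMagmaMorphism.type G (unit_group k)) (gam : G) (c : Z1 chi).
Local Notation kG := (group_algebra k G).
Local Notation th := (theta c).
Local Notation T := (skew_ring th).
Local Notation u := (sU th).
Implicit Types (r : kG) (t g : G) (p q : {poly kG}).

Definition emb (r : kG) : T :=
  \sum_(t <- msupp (r : {malg k[G]})) u ((r : {malg k[G]})@_t)%:P t.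

Lemma scoef_emb r t : scoef (emb r) t = ((r : {malg k[G]})@_t)%:P.
Proof.
rewrite [in RHS](monalgE (r : {malg k[G]})) raddf_sum raddf_sum scoef_sum.
by apply: eq_bigr => g _; rewrite scoefU /= mcoeffU polyCMn.
Qed.

Lemma embD r s : emb (r + s) = emb r + emb s.
Proof. by apply: skewP => t; rewrite scoefD !scoef_emb mcoeffD polyCD. Qed.

Lemma emb0 : emb 0 = 0.
Proof. by apply: skewP => t; rewrite scoef_emb mcoeff0 scoef0. Qed.

Lemma embZ a r : emb (a *: r) = u a%:P 1%g * emb r.
Proof.
apply: skewP => t; rewrite scoefUl ract1 invg1 mul1g !scoef_emb.
by rewrite mcoeffZ polyCM.
Qed.

Lemma emb_lin a r s : emb (a *: r + s) = u a%:P 1%g * emb r + emb s.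
Proof. by rewrite embD embZ. Qed.

Lemma emb_gelt t : emb (gelt k t) = u 1 t.
Proof. by apply: skewP => g; rewrite scoef_emb /gelt mcoeffU scoefU polyCMn. Qed.

Lemma emb1 : emb 1 = 1.
Proof. exact: (emb_gelt 1%g). Qed.

Lemma theta_C t a : th t a%:P = a%:P.
Proof. exact: comp_polyC. Qed.

Lemma uC_comm a (x : T) : u a%:P 1%g * x = x * u a%:P 1%g.
Proof.
apply: skewP => t; rewrite scoefUl scoefUr ract1 invg1 mul1g mulg1 theta_C.
exact: mulrC.
Qed.

Lemma embM r s : emb (r * s) = emb r * emb s.
Proof.
move: r s; apply: ga_bilinear_ind => [x|y|a x x' y hx hx'|a x y y' hy hy'|t g].
- by rewrite mulr0 emb0 mulr0.
- by rewrite mul0r emb0 mul0r.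
- by rewrite ga_linl !embD !embZ hx hx' mulrDl mulrA.
- by rewrite ga_linr !embD !embZ hy hy' mulrDr mulrA uC_comm mulrA.
by rewrite -geltM !emb_gelt sUM rmorph1 mulr1.
Qed.

(** This is the relation [X u_t = u_t (chi(t) X + c(t))]. *)
Lemma theta_X t : 'X = (ugval (chi t))%:P * th t 'X + (c t)%:P.
Proof.
have tX : th t (aff_poly (Phi c t)) = 'X.
  by rewrite /= -aff_polyM mulgV aff_poly1.
by rewrite -[LHS]tX [X in th t X]/aff_poly rmorphD /= comp_polyC comp_polyZ mul_polyC.
Qed.

(** The image [u_gam X] of the variable [t = gam s]. *)
Definition imt : T := u (th gam 'X) gam.

(** The commutation rule that defines the Ore extension holds for the image of
    its variable; by linearity it suffices to check it on group elements. *)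
Lemma imt_emb r :
  imt * emb r = emb (sigma_map chi gam r) * imt + emb (delta_map gam c r).
Proof.
pose P x := imt * emb x = emb (sigma_map chi gam x) * imt + emb (delta_map gam c x).
have P0 : P 0 by rewrite /P !linear0 !emb0 mulr0 mul0r addr0.
have PZ a x y : P x -> P y -> P (a *: x + y).
  rewrite /P (sigma_lin chi gam a x y) (delta_lin gam c a x y) => hx hy.
  rewrite (emb_lin a x y) (emb_lin a (sigma_map _ _ x)) (emb_lin a (delta_map _ _ x)).
  rewrite mulrDr (mulrA imt) -uC_comm -(mulrA (u _ _) imt) hx hy.
  by rewrite mulrDr !mulrDl !mulrA addrACA.
rewrite -/(P r) (ga_decomp r) lin_ext.unlock.
elim: (enum_fset _) => [|t s IH]; first by rewrite big_nil.
rewrite big_cons; apply: PZ => //; rewrite /P (sigma_gelt chi gam t) (delta_gelt gam c t).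
rewrite !(embZ _ (gelt k _)) !emb_gelt /imt !sUM.
rewrite (rmorph1 (th gam)) (rmorph1 (th 1%g)) !mulr1 !mul1g !mulgVK.
rewrite -sUD; congr (u _ _).
by rewrite -ractM mulgVK ractM [X in th gam X](theta_X t) rmorphD rmorphM !theta_C.
Qed.

Definition ore_to_skew (p : oreA gam c) : T :=
  \sum_(i < size (p : {poly kG})) emb (p : {poly kG})`_i * imt ^+ i.

Lemma ore_to_skew_w n p : (size p <= n)%N ->
  ore_to_skew p = \sum_(i < n) emb p`_i * imt ^+ i.
Proof.
move=> le; rewrite /ore_to_skew (big_ord_widen n (fun i => emb p`_i * imt ^+ i)) //.
rewrite big_mkcond; apply: eq_bigr => i _; case: ltnP => // h.
by rewrite nth_default // emb0 mul0r.
Qed.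

Lemma ore_to_skewD p q : ore_to_skew (p + q) = ore_to_skew p + ore_to_skew q.
Proof.
pose n := maxn (size p) (size q).
rewrite (@ore_to_skew_w n p) ?leq_maxl // (@ore_to_skew_w n q) ?leq_maxr //.
rewrite (@ore_to_skew_w n) ?size_polyD // -big_split.
by apply: eq_bigr => i _; rewrite coefD embD mulrDl.
Qed.

Lemma ore_to_skew0 : ore_to_skew 0 = 0.
Proof. by rewrite /ore_to_skew size_poly0 big_ord0. Qed.

Lemma ore_to_skewZ r p : ore_to_skew (r *: p) = emb r * ore_to_skew p.
Proof.
rewrite (@ore_to_skew_w (size p)) ?size_scale_leq // /ore_to_skew mulr_sumr.
by apply: eq_bigr => i _; rewrite coefZ embM mulrA.
Qed.

Lemma ore_to_skew_t p :
  ore_to_skew (ore_t (delta gam c) p) = imt * ore_to_skew p.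
Proof.
have le : (size (ore_t (delta gam c) p) <= (size p).+1)%N.
  apply/leq_sizeP => i hi; rewrite coef_ore_t nth_default ?(ltnW hi) // sder0.
  by case: i hi => [|i] hi; rewrite ?nth_default ?rmorph0 ?addr0.
rewrite (ore_to_skew_w le) /ore_to_skew mulr_sumr.
under eq_bigr do rewrite coef_ore_t embD mulrDl.
rewrite big_split /= big_ord_recl /= emb0 mul0r add0r.
rewrite big_ord_recr /= nth_default // sder0 emb0 mul0r addr0 -big_split /=.
apply: eq_bigr => i _; rewrite [RHS]mulrA.
have -> := imt_emb p`_i.
by rewrite mulrDl -mulrA -exprS.
Qed.

Lemma ore_to_skewM (p q : oreA gam c) :
  ore_to_skew (p * q) = ore_to_skew p * ore_to_skew q.
Proof.
have -> : p * q = ore_mul (delta gam c) p q by [].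
rewrite ore_mul.unlock (big_morph _ ore_to_skewD ore_to_skew0).
rewrite [X in X * _]/ore_to_skew mulr_suml; apply: eq_bigr => i _.
rewrite ore_to_skewZ -mulrA; congr (_ * _); elim: (i : nat) => [|n IH].
  by rewrite expr0 mul1r.
by rewrite iterS ore_to_skew_t IH exprS mulrA.
Qed.

Lemma ore_to_skew1 : ore_to_skew 1 = 1.
Proof.
rewrite (@ore_to_skew_w 1) ?size_poly1 // big_ord1 coef1 /= expr0 mulr1.
exact: emb1.
Qed.

Lemma ore_to_skewB (p q : oreA gam c) :
  ore_to_skew (p - q) = ore_to_skew p - ore_to_skew q.
Proof. by apply/eqP; rewrite -subr_eq opprK -ore_to_skewD subrK. Qed.

HB.instance Definition _ :=
  GRing.isZmodMorphism.Build (oreA gam c) T ore_to_skew ore_to_skewB.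
HB.instance Definition _ :=
  GRing.isMonoidMorphism.Build (oreA gam c) T ore_to_skew
    (ore_to_skew1, ore_to_skewM).

Lemma ore_to_skew_monom r n : ore_to_skew (r *: 'X^n) = emb r * imt ^+ n.
Proof.
rewrite ore_to_skewZ -(iter_t1 (delta gam c)); congr (_ * _).
elim: n => [|n IH] /=; first exact: ore_to_skew1.
by rewrite ore_to_skew_t IH exprS.
Qed.

Lemma size_theta t f : size (th t f) = size f.
Proof.
have size2 : size (aff_poly (Phi c t)^-1%g) = 2.
  by rewrite /aff_poly size_polyDl size_scale ?ugvalP ?size_polyX // ltnS size_polyC_leq1.
by rewrite /= size_comp_poly2.
Qed.

(** This triangularity in the degree is what makes [ore_to_skew] bijective. *)
Lemma imtX n : exists2 q, imt ^+ n = u q (gam ^+ n)%g & size q = n.+1.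
Proof.
elim: n => [|n [q qE sq]].
  by exists 1; rewrite ?size_poly1 // expr0.
exists (th gam 'X * th gam q); first by rewrite exprS qE sUM expgS.
by rewrite -rmorphM size_theta mulrC size_mulX ?sq // -size_poly_eq0 sq.
Qed.

(** In a suitable coefficient of the image, the leading coefficient of [p]
    contributes a polynomial of degree [deg p], the others polynomials of
    smaller degree. *)
Lemma ore_to_skew_inj : injective ore_to_skew.
Proof.
suff ker0 p : ore_to_skew p = 0 -> p = 0.
  move=> p q e; apply/eqP; rewrite -subr_eq0; apply/eqP/ker0.
  by apply/eqP; rewrite [ore_to_skew _]ore_to_skewB e subrr.
apply: contraPP => /eqP p0 fp0.
have [n szp] : exists n, size p = n.+1.
  by exists (size p).-1; rewrite prednK // lt0n size_poly_eq0.
have lead0 : p`_n != 0 by move: p0; rewrite -lead_coef_eq0 lead_coefE szp.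
have [g pg0] : exists g, (p`_n : {malg k[G]})@_g != 0.
  apply: contrapT => nex; case/eqP: lead0; apply/malgP => g.
  by rewrite mcoeff0; apply/eqP; apply: contrapT => /negP pg; apply: nex; exists g.
have term m : exists2 q, scoef (emb p`_m * imt ^+ m) (g * gam ^+ n)%g = q &
    (size q <= m.+1)%N /\ (m = n -> size q = n.+1).
  have [q qE sq] := imtX m; rewrite qE; eexists; first exact: scoefUr.
  rewrite scoef_emb mul_polyC; split=> [|mn].
    by apply: leq_trans (size_scale_leq _ _) _; rewrite size_theta sq.
  by rewrite mn mulgK size_scale // size_theta sq mn.
have := congr1 (fun x => scoef x (g * gam ^+ n)%g) fp0.
rewrite /= scoef0 (@ore_to_skew_w n.+1) ?szp // big_ord_recr scoefD scoef_sum /=.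
have [q -> [_ /(_ erefl) sq]] := term n.
move=> /(congr1 (fun f : {poly k} => size f)); rewrite addrC size_polyDl ?sq ?size_poly0 //.
apply: leq_ltn_trans (size_sum _ _ _) _; rewrite ltnS; apply/bigmax_leqP => i _.
by have [r -> [/leq_trans -> //]] := term i; rewrite ltn_ord.
Qed.

Lemma ore_gradingD a (p q : oreA gam c) :
  ore_grading gam c a p -> ore_grading gam c a q -> ore_grading gam c a (p + q).
Proof.
move=> hp hq n; have [x px] := hp n; have [y qy] := hq n.
by exists (x + y); rewrite coefD px qy scalerDl.
Qed.

(** The coefficient of [u_a] can be adjusted in each degree [n], by the image of
    [k (a gam^-n) t^n]. *)
Lemma ore_to_skew_homogeneous a f :
  exists2 p, ore_grading gam c a p & ore_to_skew p = u f a.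
Proof.
have [n] := ubnP (size f); elim: n f => // n IHn f /ltnSE.
rewrite leq_eqVlt => /orP[/eqP szf|]; last exact: IHn.
case: n szf IHn => [/eqP|n] szf IHn.
  move: szf; rewrite size_poly_eq0 => /eqP ->; exists 0.
    by move=> n; exists 0; rewrite coef0 scale0r.
  by rewrite ore_to_skew0 /sU monalgU0.
have [q qE sq] := imtX n; pose t := (a * gam ^- n)%g; pose q' := th t q.
have sq' : size q' = n.+1 by rewrite size_theta.
have q'0 : lead_coef q' != 0 by rewrite lead_coef_eq0 -size_poly_eq0 sq'.
pose x := lead_coef f / lead_coef q'.
have imE : ore_to_skew ((x *: gelt k t) *: 'X^n) = u (x *: q') a.
  rewrite ore_to_skew_monom embZ emb_gelt qE !sUM ract1 mulr1 mul1g mulgVK.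
  by rewrite -mul_polyC.
have [|p pa pE] := IHn (f - x *: q').
  rewrite ltnS; apply/leq_sizeP => j; rewrite leq_eqVlt => /orP[/eqP <-|nj].
    rewrite coefB coefZ.
    have -> : f`_n = lead_coef f by rewrite lead_coefE szf.
    have -> : q'`_n = lead_coef q' by rewrite lead_coefE sq'.
    by rewrite divfK // subrr.
  by rewrite coefB coefZ !nth_default ?szf ?sq' // mulr0 subr0.
exists ((x *: gelt k t) *: 'X^n + p).
  apply: ore_gradingD => // m; rewrite coefZ coefXn.
  case: eqP => [->|_]; first by exists x; rewrite mulr1.
  by exists 0; rewrite mulr0 scale0r.
by rewrite ore_to_skewD imE pE -sUD addrC subrK.
Qed.

Lemma ore_to_skew_surj x : exists p, ore_to_skew p = x.
Proof.
rewrite (skew_sum x); elim: (enum_fset _) => [|t s [p pE]].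
  by exists 0; rewrite big_nil ore_to_skew0.
have [q _ qE] := ore_to_skew_homogeneous t (scoef x t).
by exists (q + p); rewrite big_cons ore_to_skewD pE qE.
Qed.

Lemma ore_to_skew_graded a p : ore_grading gam c a p ->
  exists f, ore_to_skew p = u f a.
Proof.
move=> pa; rewrite /ore_to_skew; elim/big_rec: _ => [|i _ _ [f ->]].
  by exists 0; rewrite /sU monalgU0.
have [x ->] := pa i; have [q -> _] := imtX i.
rewrite embZ emb_gelt !sUM ract1 mul1g mulgVK -sUD.
by eexists.
Qed.

Lemma ore_to_skew_iso :
  exists f : {rmorphism oreA gam c -> T},
    graded_ring_iso (ore_grading gam c) (skew_grading th) f /\
    f (ore_const (delta gam c) (gelt k gam^-1%g) * ore_var (delta gam c))
      = (<< 'X *g 1%g >> : {malg {poly k}[G]}).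
Proof.
exists ore_to_skew; split; last first.
  have varE : ore_to_skew (ore_var (delta gam c)) = imt.
    have := ore_to_skew_monom 1 1; rewrite scale1r emb1 mul1r !expr1.
    exact.
  have constE r : ore_to_skew (ore_const (delta gam c) r) = emb r.
    have := ore_to_skew_monom r 0; rewrite !expr0 mulr1 alg_polyC.
    exact.
  rewrite rmorphM /= varE constE emb_gelt /imt sUM mulVg mul1r -ractM mulVg ract1.
  by [].
split=> [|a].
  have [g gK] := choice ore_to_skew_surj.
  by exists g => // p; apply: ore_to_skew_inj; rewrite gK.
apply/seteqP; split=> [_ [p pa <-]|_ [f _ <-]].
  by have [f fE] := ore_to_skew_graded pa; exists f.
by have [p pa pE] := ore_to_skew_homogeneous a f; exists p.
Qed.

End OreSkewIso.

(** * Inner derivations and metabelian groups *)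

(** The coefficient of [gam t] in [v t - sigma(t) v] is [v_gam (1 - chi t)], so
    only the coefficient of [v] at [gam] matters. *)
Lemma delta_innerP (k : fieldType) (G : groupType)
    (chi : UMagmaMorphism.type G (unit_group k)) (gam : G) (c : Z1 chi) :
  inner_derivation (delta gam c) <-> c \in B1 chi.
Proof.
split=> [[v vE]|/asboolP[x cE]].
  pose coef (r : group_algebra k G) g := scoef (r : skew_ring (triv_action G k)) g.
  apply/asboolP; exists (- coef v gam) => t.
  have := congr1 (fun r => coef r (gam * t)%g) (vE (gelt k t)).
  rewrite /delta /sigma /= delta_gelt sigma_gelt !scale_gelt.
  rewrite /coef scoefB scoefUr scoefUl scoefU eqxx mulr1n /= mulr1 mulgK.
  by rewrite !invgM invgK !mulgA !mulgVK => ->; rewrite mulNr mulrBr mulr1 opprB mulrC.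
(* The witness is [- x] at [gam], since the coefficient at [gam] of an inner
     derivation gives the coboundary of its opposite. *)
have term a t : a *: (c t *: gelt k (gam * t)%g) =
    (- x *: gelt k gam) * (a *: gelt k t) -
    (a *: (ugval (chi t) *: gelt k (gam * t * gam^-1)%g)) * (- x *: gelt k gam).
  rewrite -!ga_scalerAl -!ga_scalerAr -!geltM mulgVK !scalerA -scalerBl cE.
  by congr (_ *: _); ring.
exists (- x *: gelt k gam) => r.
rewrite (ga_decomp r) lin_ext.unlock /delta /sigma /= !linear_sum mulr_sumr mulr_suml.
rewrite -sumrB; apply: eq_bigr => t _; rewrite !linearZ /= delta_gelt sigma_gelt.
exact: term.
Qed.

(** The kernel of [chi] is abelian because [Phi] embeds it in the group of
    translations. *)
Lemma metabelian_of_injective (k : fieldType) (G : groupType)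
    (chi : UMagmaMorphism.type G (unit_group k)) (c : Z1 chi) :
  injective (Phi c) -> metabelian G.
Proof.
move=> Pinj.
have unitC (a b : unit_group k) : (a * b = b * a)%g by apply/val_inj/mulrC.
have kerP : group_closed (fun t => chi t == 1%g).
  split=> [|t r]; first by rewrite unfold_in gmulf1.
  by rewrite !unfold_in gmulfF => /eqP -> /eqP ->; rewrite mulgV.
exists (group_of_closed kerP); split=> [g n /eqP n1|m n /eqP m1 /eqP n1|x y].
- by apply/eqP; rewrite /conjg !gmulfM gmulfV n1 mul1g mulVg.
- apply: Pinj; rewrite /Phi !gmulfM !Z1E m1 n1 /= !mul1r addrC.
  by rewrite (unitC (chi m)).
have sub g h : lcoset_of (group_of_closed kerP) (g * h)%g
    `<=` lcoset_of (group_of_closed kerP) (h * g)%g.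
  move=> _ [n /eqP n1 <-]; exists ((h * g)^-1 * (g * h * n))%g; last exact: mulVKg.
  by apply/eqP; rewrite !(gmulfM, gmulfV) n1 mulg1 (unitC (chi h)) mulVg.
by apply/seteqP; split; apply: sub.
Qed.

Theorem theorem3 (k : fieldType)
    (kbar : closedFieldType) (iota : {rmorphism k -> kbar})
    (kbar_algebraic : forall x : kbar, algebraicOver iota x)
    (G : groupType) (gam : G)
    (chi : UMagmaMorphism.type G (unit_group k)) (c : Z1 chi) :
  [/\ (* (1) *)
      inner_derivation (delta gam c) <-> c \in B1 chi,
      (* (2) *)
      exists f : {rmorphism oreA gam c -> skew_ring (theta c)},
        graded_ring_iso (ore_grading gam c)
          (skew_grading (theta c)) f /\
        f (ore_const (delta gam c) (gelt k gam^-1%g) * ore_var (delta gam c))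
          = (<< 'X *g 1%g >> : {malg {poly k}[G]}),
      (* (3) *)
      [/\ gr_simple (ore_grading gam c) <->
            (forall x : kbar, ~ finite_set (Phi_orbit c iota x)),
          (forall x : kbar, ~ finite_set (Phi_orbit c iota x)) <->
            (forall H : groupClosed G, finite_index H ->
               H1_class (res_cocycle H c) <> 0)
        & [pchar k] =i pred0 ->
            (gr_simple (ore_grading gam c) <-> H1_class c <> 0)]
    & (* (4) *)
      (simple_ring (oreA gam c) <->
         gr_simple (ore_grading gam c) /\ injective (Phi c)) /\
      (simple_ring (oreA gam c) -> metabelian G)].
Proof.
have [f [fiso fs]] := ore_to_skew_iso gam c; have [fbij fgr] := fiso.
have grP : gr_simple (ore_grading gam c) <->
    (forall x : kbar, ~ finite_set (Phi_orbit c iota x)).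
  by rewrite (iso_gr_simple fbij fgr); apply: gr_simple_skewP.
have simP : simple_ring (oreA gam c) <->
    gr_simple (ore_grading gam c) /\ injective (Phi c).
  by rewrite (iso_simple fbij) (iso_gr_simple fbij fgr); apply: simple_skewP.
split.
- exact: delta_innerP.
- by exists f.
- split=> [//||char0]; first exact: finite_orbit_res.
  by rewrite grP; apply: finite_orbit_pchar0.
by split=> // /simP[_]; apply: metabelian_of_injective.
Qed.
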